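(* Let $r\ge 1$, let $\tau$ be a bijection from $F^r$ to $F^r$ with $\tau({\bf 0})={\bf 0}$, and let $l$ be the distension of $\tau$. Then the rank of the code $S_{\mathcal H,\tau}=\bigcup_{a\in F^r}\mathcal H_a\times\mathcal H_{\tau(a)}$ is $(2^{r+1}-r-2)+l$.
   Context: $F=\mathrm{GF}(2)$; a code of length $n$ is a set of vectors of $F^n$. $\mathrm{wt}$ is Hamming weight. ${\bf 0}$ denotes the all-zero vector. The rank of a code $C$ is the dimension of its linear span over $F$. The coordinates of $F^{2^r}$ are indexed by the vectors of $F^r$; $e_a$ is the vector whose only nonzero coordinate is the one indexed by $a$. $\mathcal H=\{c\in F^{2^r}:\sum_{a:c_a=1}a={\bf 0},\ \mathrm{wt}(c)\equiv 0 \pmod 2\}$, and $\mathcal H_a=\mathcal H+e_a+e_{\bf 0}$ for $a\in F^r$. For codes $C,D$, $C\times D=\{x|y: x\in C,\ y\in D\}$, where $x|y$ is concatenation. A bijection $\tau:F^r\to F^r$ is regarded as a permutation of the coordinate positions of $F^{2^r}$, acting on $x\in F^{2^r}$ by $\tau(x)_b=x_{\tau^{-1}(b)}$; $\tau(\mathcal H)=\{\tau(x):x\in\mathcal H\}$. The distension of $\tau$ (with $\tau({\bf 0})={\bf 0}$) is $2^r-r-1-\dim(\mathcal H\cap\tau(\mathcal H))$, where $2^r-r-1=\dim(\mathcal H)$. *)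

(* Defs.v *)
From mathcomp Require Import all_boot all_order all_fingroup all_algebra.

Set Implicit Arguments.
Unset Strict Implicit.
Unset Printing Implicit Defensive.

Import GRing.Theory.
Local Open Scope ring_scope.

(* F ^ I, for a finite set I of coordinate positions.  The field is taken as
   ('F_2)^o, i.e. as a vector space over itself, so that the type below is
   inferred to be both a vector space over 'F_2 and a finite type. *)
Notation word I := {ffun I -> ('F_2)^o}.

Definition code (I : finType) := {set word I}.

Definition wt (I : finType) (c : word I) : nat := #|[set i | c i != 0]|.

(* For a linear code this is its dimension. *)
Definition rank (I : finType) (C : code I) : nat := \dim <<enum C>>%VS.

Definition unitw (I : finType) (a : I) : word I := [ffun b => (b == a)%:R].

(* The positions of x|y are the disjoint union of those of x and of y. *)
Definition concat (I J : finType) (x : word I) (y : word J) : word (I + J)%type :=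
  [ffun k => match k with inl i => x i | inr j => y j end].

Definition code_prod (I J : finType) (C : code I) (D : code J) : code (I + J)%type :=
  [set concat x y | x in C, y in D].

Definition perm_word (I : finType) (tau : {perm I}) (x : word I) : word I :=
  [ffun b => x ((tau^-1)%g b)].

Definition perm_code (I : finType) (tau : {perm I}) (C : code I) : code I :=
  [set perm_word tau x | x in C].

Section Hamming.

Variable r : nat.
Local Notation V := 'rV['F_2]_r.

Definition hamming : code V :=
  [set c : word V | (\sum_(a : V | c a == 1) a == 0) && ~~ odd (wt c)].

Definition hamming_coset (a : V) : code V :=
  [set c + unitw a + unitw 0 | c : word V in hamming].

(* The intersection is linear, so its rank is its dimension; being a subspace
   of hamming, whose dimension is 2 ^ r - r - 1, it never makes the truncated
   subtraction round up to 0. *)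
Definition distension (tau : {perm V}) : nat :=
  (2 ^ r - r - 1 - rank (hamming :&: perm_code tau hamming))%N.

Definition SHtau (tau : {perm V}) : code (V + V)%type :=
  \bigcup_(a : V) code_prod (hamming_coset a) (hamming_coset (tau a)).

End Hamming.

(* Main.v *)
From HB Require Import structures.
Require Import Defs.
From mathcomp Require Import all_boot all_order all_fingroup all_algebra.
From mathcomp Require Import zify.

(* With s the syndrome map, H = ker s, and E the space of even-weight words,
   the span of S_{H,tau} is H x H + {tau^-1(y)|y : y in E}, because the words
   e_b + e_0 span E.  The second summand meets H x H in the image of the
   intersection of H and tau(H), so the rank is
   2 dim H + dim E - dim (H & tau H), where dim H = 2^r - r - 1 and
   dim E = 2^r - 1. *)

Import GRing.Theory.
Local Open Scope ring_scope.

Set Implicit Arguments.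
Unset Strict Implicit.

Lemma rank_vspace (I : finType) (C : code I) (U : {vspace word I}) :
  (forall c, (c \in C) = (c \in U)) -> rank C = \dim U.
Proof.
move=> CU; congr (\dim _); apply/vspaceP => c; apply/idP/idP.
  by move: c; apply/subvP/span_subvP => c; rewrite mem_enum CU.
by rewrite -CU => Cc; apply: memv_span; rewrite mem_enum.
Qed.

Lemma F2_nat_eq1 (x : 'F_2) : x = (x == 1)%:R.
Proof. by case: x => [[|[|//]]] ltx; apply/val_inj. Qed.

Lemma F2_neq0 (x : 'F_2) : (x != 0) = (x == 1).
Proof. by rewrite [x]F2_nat_eq1; case: (x == 1). Qed.

Lemma natF2_eq0 (n : nat) : ((n%:R : 'F_2) == 0) = ~~ odd n.
Proof. by rewrite -dvdn2 (dvdn_pcharf (pchar_Fp (isT : prime 2))). Qed.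

(** * Parity and the space of even-weight words *)

Section Parity.

Variable I : finType.

Definition parity (c : word I) : ('F_2)^o := \sum_a c a.

Lemma parity_is_linear : linear parity.
Proof.
move=> k x y; rewrite /parity scaler_sumr -big_split /=.
by apply: eq_bigr => a _; rewrite !ffunE.
Qed.

HB.instance Definition _ :=
  GRing.isLinear.Build 'F_2 (word I) ('F_2)^o _ parity parity_is_linear.

Definition even_words : {vspace word I} := lker (linfun parity).

Lemma mem_even_words c : (c \in even_words) = (parity c == 0).
Proof. by rewrite memv_ker lfunE. Qed.

Lemma parity_wt c : parity c = (wt c)%:R.
Proof.
rewrite /parity /wt -sum1dep_card natr_sum [RHS]big_mkcond /=.
by apply: eq_bigr => a _; rewrite F2_neq0 {1}(F2_nat_eq1 (c a)); case: ifP.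
Qed.

Lemma parity_unitw a : parity (unitw a) = 1.
Proof.
rewrite /parity (bigD1 a) //= big1 ?ffunE ?eqxx ?addr0 // => b /negPf nb.
by rewrite ffunE nb.
Qed.

Lemma word_sum_unitw (c : word I) : c = \sum_b (c b : 'F_2) *: unitw b.
Proof.
apply/ffunP => a; rewrite sum_ffunE (bigD1 a) //= big1 => [|b nb].
  by rewrite !ffunE eqxx addr0 /GRing.scale /= mulr1.
by rewrite !ffunE eq_sym (negPf nb) scaler0.
Qed.

Lemma dim_word : \dim {:word I} = #|I|.
Proof. by rewrite dimvf; exact: muln1. Qed.

(** Rank-nullity: [parity] is onto since a unit word has parity 1. The position [a] witnesses that
    [I] is nonempty. *)
Lemma dim_even_words (a : I) : (\dim even_words + 1 = #|I|)%N.
Proof.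
rewrite -dim_word -(limg_ker_dim (linfun parity) fullv) capfv; congr (_ + _)%N.
suff -> : limg (linfun parity) = fullv by rewrite dimvf.
apply/eqP; rewrite eqEsubv subvf; apply/subvP => x _; apply/memv_imgP.
exists ((x : 'F_2) *: unitw a); rewrite ?memvf // lfunE linearZ /= parity_unitw.
by rewrite /GRing.scale /= mulr1.
Qed.

(** Replacing each [unitw b] by [unitw b + unitw a] in the expansion of [c] adds
    [parity c *: unitw a], which vanishes. *)
Lemma even_sum_unitw (a : I) c : c \in even_words ->
  c = \sum_b (c b : 'F_2) *: (unitw b + unitw a).
Proof.
rewrite mem_even_words => /eqP c0; under eq_bigr do rewrite scalerDr.
by rewrite big_split /= -scaler_suml -/(parity c) c0 scale0r addr0 -word_sum_unitw.
Qed.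

Lemma even_unitwD a b : unitw a + unitw b \in even_words.
Proof. by rewrite mem_even_words linearD /= !parity_unitw; apply/eqP/val_inj. Qed.

End Parity.

(** * Products of subspaces under concatenation *)

Section Concatenation.

Variables I J : finType.

Lemma concat_linear k (x x' : word I) (y y' : word J) :
  concat (k *: x + x') (k *: y + y') = k *: concat x y + concat x' y'.
Proof. by apply/ffunP => -[i|j]; rewrite !ffunE. Qed.

Lemma concatD (x x' : word I) (y y' : word J) :
  concat (x + x') (y + y') = concat x y + concat x' y'.
Proof. by apply/ffunP => -[i|j]; rewrite !ffunE. Qed.

Lemma concat_inj (x x' : word I) (y y' : word J) :
  concat x y = concat x' y' -> x = x' /\ y = y'.
Proof.
by move=> /ffunP e; split; apply/ffunP => i;
  [have := e (inl i) | have := e (inr i)]; rewrite !ffunE.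
Qed.

Definition inlw (x : word I) : word (I + J)%type := concat x 0.
Definition inrw (y : word J) : word (I + J)%type := concat 0 y.

Lemma inlw_is_linear : linear inlw.
Proof. by move=> k x y; rewrite /inlw -concat_linear scaler0 addr0. Qed.

Lemma inrw_is_linear : linear inrw.
Proof. by move=> k x y; rewrite /inrw -concat_linear scaler0 addr0. Qed.

HB.instance Definition _ :=
  GRing.isLinear.Build 'F_2 (word I) (word (I + J)%type) _ inlw inlw_is_linear.
HB.instance Definition _ :=
  GRing.isLinear.Build 'F_2 (word J) (word (I + J)%type) _ inrw inrw_is_linear.

(** The linear counterpart of [code_prod]; as a sum of two embedded copies it has a computable
    dimension. *)
Definition prodv (U : {vspace word I}) (V : {vspace word J}) :=
  (linfun inlw @: U + linfun inrw @: V)%VS.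

Lemma mem_prodv U V x y :
  (concat x y \in prodv U V) = (x \in U) && (y \in V).
Proof.
apply/idP/andP.
  case/memv_addP=> _ /memv_imgP[u Uu ->] [_ /memv_imgP[v Vv ->]].
  by rewrite !lfunE -concatD addr0 add0r => /concat_inj[-> ->].
case=> Ux Vy; rewrite -[x]addr0 -[y]add0r concatD.
by apply: memv_add; apply/memv_imgP; [exists x | exists y]; rewrite ?lfunE.
Qed.

Lemma dim_prodv U V : \dim (prodv U V) = (\dim U + \dim V)%N.
Proof.
rewrite dimv_disjoint_sum; last first.
  apply/eqP; rewrite -subv0; apply/subvP => w /memv_capP[/memv_imgP[u _ ->]].
  case/memv_imgP=> v _; rewrite !lfunE memv0 => /concat_inj[-> _].
  by rewrite linear0.
congr (_ + _)%N; apply: limg_dim_eq; apply/eqP; rewrite -subv0; apply/subvP => x;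
  rewrite memv_cap memv_ker lfunE memv0 => /andP[_ /eqP].
  by rewrite -(linear0 inlw) => /concat_inj[-> _].
by rewrite -(linear0 inrw) => /concat_inj[_ ->].
Qed.

End Concatenation.

(** * Coordinate permutations and their graphs *)

Section PermWord.

Variables (I : finType) (tau : {perm I}).

Lemma perm_word_is_linear : linear (perm_word tau).
Proof. by move=> k x y; apply/ffunP => i; rewrite !ffunE. Qed.

HB.instance Definition _ :=
  GRing.isLinear.Build 'F_2 (word I) (word I) _ (perm_word tau) perm_word_is_linear.

Lemma perm_word_unitw a : perm_word tau (unitw a) = unitw (tau a).
Proof. by apply/ffunP => i; rewrite !ffunE -(can2_eq (permKV tau) (permK tau)). Qed.

Lemma perm_wordK : cancel (perm_word tau) (perm_word tau^-1%g).
Proof. by move=> x; apply/ffunP => i; rewrite !ffunE invgK permK. Qed.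

(** The graph is parametrised by its second half, so that membership in a product H x H becomes
    membership of [y] in both H and tau(H). *)
Definition graphw (y : word I) : word (I + I)%type := concat (perm_word tau^-1%g y) y.

End PermWord.

Lemma perm_wordKV (I : finType) (tau : {perm I}) :
  cancel (perm_word tau^-1%g) (perm_word tau).
Proof. by move=> x; have := perm_wordK tau^-1%g x; rewrite invgK. Qed.

Lemma mem_perm_code (I : finType) (tau : {perm I}) (C : code I) y :
  (y \in perm_code tau C) = (perm_word tau^-1%g y \in C).
Proof.
apply/imsetP/idP => [[x Cx ->]|Cy]; first by rewrite perm_wordK.
by exists (perm_word tau^-1%g y); rewrite ?perm_wordKV.
Qed.

Lemma graphw_is_linear (I : finType) (tau : {perm I}) : linear (graphw tau).
Proof. by move=> k x y; rewrite /graphw linearP concat_linear. Qed.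

HB.instance Definition _ (I : finType) (tau : {perm I}) :=
  GRing.isLinear.Build 'F_2 (word I) (word (I + I)%type) _
    (graphw tau) (graphw_is_linear tau).

Lemma dim_graphw (I : finType) (tau : {perm I}) (U : {vspace word I}) :
  \dim (linfun (graphw tau) @: U) = \dim U.
Proof.
apply: limg_dim_eq; apply/eqP; rewrite -subv0; apply/subvP => y.
rewrite memv_cap memv_ker lfunE memv0 => /andP[_ /eqP].
by rewrite -(linear0 (graphw tau)) => /concat_inj[_ ->].
Qed.

(** * The extended Hamming code and the span of the union *)

Section Hamming.

Variable r : nat.
Local Notation V := 'rV['F_2]_r.

(** Carrying the parity as a second component makes the code the kernel of a single linear map. *)
Definition syndrome (c : word V) : V * ('F_2)^o :=
  (\sum_a (c a : 'F_2) *: a, parity c).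

Lemma syndrome_is_linear : linear syndrome.
Proof.
move=> k x y; congr (_, _); last exact: linearP.
rewrite /= scaler_sumr -big_split /=; apply: eq_bigr => a _.
by rewrite !ffunE scalerDl scalerA.
Qed.

HB.instance Definition _ :=
  GRing.isLinear.Build 'F_2 (word V) (V * ('F_2)^o)%type _ syndrome syndrome_is_linear.

Definition hammingv : {vspace word V} := lker (linfun syndrome).

Lemma mem_hammingv c : (c \in hamming r) = (c \in hammingv).
Proof.
rewrite inE memv_ker lfunE /= -natF2_eq0 -parity_wt -pair_eqE /= big_mkcond /=.
congr ((_ == 0) && _); apply: eq_bigr => a _.
by rewrite [in RHS](F2_nat_eq1 (c a)); case: (c a == 1); rewrite ?scale1r ?scale0r.
Qed.

Lemma hammingv_even : (hammingv <= even_words V)%VS.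
Proof.
apply/subvP => c; rewrite memv_ker lfunE mem_even_words => /eqP Hc.
by rewrite -[parity c]/(syndrome c).2 Hc.
Qed.

Lemma syndrome_unitw a : syndrome (unitw a) = (a, 1).
Proof.
rewrite /syndrome parity_unitw; congr (_, _).
rewrite (bigD1 a) //= big1 ?ffunE ?eqxx ?addr0 ?scale1r // => b /negPf nb.
by rewrite ffunE nb scale0r.
Qed.

Lemma dim_hammingv : (\dim hammingv + (r + 1) = 2 ^ r)%N.
Proof.
have cardV : #|V| = (2 ^ r)%N by rewrite card_mx card_Fp // mul1n.
rewrite -cardV -dim_word -(limg_ker_dim (linfun syndrome) fullv) capfv; congr (_ + _)%N.
suff -> : limg (linfun syndrome) = fullv.
  by rewrite dimvf -[r in LHS]mul1n.
apply/eqP; rewrite eqEsubv subvf; apply/subvP => -[v t] _; apply/memv_imgP.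
(* The syndromes of [unitw v] and [unitw 0] are [(v, 1)] and [(0, 1)], so a multiple of [unitw 0]
   corrects the parity without disturbing [v]. *)
exists (unitw v + (t - 1 : 'F_2) *: unitw 0); rewrite ?memvf // lfunE.
rewrite linearD linearZ /= !syndrome_unitw; congr (_, _); rewrite /= ?scaler0 ?addr0 //.
by rewrite /GRing.scale /= mulr1 addrC subrK.
Qed.

(** This is the intersection of H and tau(H), with tau(H) encoded as the preimage of H under the
    inverse permutation. *)
Definition perm_capv (tau : {perm V}) : {vspace word V} :=
  (hammingv :&: linfun (perm_word tau^-1%g) @^-1: hammingv)%VS.

Lemma dim_perm_capv (tau : {perm V}) : (\dim (perm_capv tau) <= \dim hammingv)%N.
Proof. exact: dimvS (capvSl _ _). Qed.

Lemma distensionE (tau : {perm V}) : distension tau =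
  (\dim hammingv - \dim (perm_capv tau))%N.
Proof.
rewrite /distension -dim_hammingv -[(_ - r - 1)%N]subnDA addnK; congr (_ - _)%N.
apply: rank_vspace => c.
by rewrite inE mem_perm_code memv_cap -memv_preim lfunE /= !mem_hammingv.
Qed.

Lemma span_SHtau (tau : {perm V}) : tau 0 = 0 ->
  <<enum (SHtau tau)>>%VS =
  (prodv hammingv hammingv + linfun (graphw tau) @: even_words V)%VS.
Proof.
move=> tau0.
(* The shift defining the coset pair indexed by [a] is itself a graph word, because tau fixes 0. *)
have graph_unitw a : graphw tau (unitw (tau a) + unitw 0) =
    concat (unitw a + unitw 0) (unitw (tau a) + unitw 0).
  have tauV0 : (tau^-1)%g 0 = 0 by rewrite -{1}tau0 permK.
  by rewrite /graphw linearD /= !perm_word_unitw permK tauV0.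
have SHtauI a x y : x \in hammingv -> y \in hammingv ->
    concat (x + unitw a + unitw 0) (y + unitw (tau a) + unitw 0)
      \in <<enum (SHtau tau)>>%VS.
  move=> Hx Hy; apply: memv_span; rewrite mem_enum; apply/bigcupP; exists a => //.
  by apply/imset2P; exists (x + unitw a + unitw 0) (y + unitw (tau a) + unitw 0) => //;
    apply/imsetP; [exists x | exists y]; rewrite ?mem_hammingv.
have unitwK a : unitw a + unitw a = 0 :> word V.
  by apply/ffunP => b; rewrite !ffunE; case: eqP => _; apply/val_inj.
apply/eqP; rewrite eqEsubv; apply/andP; split.
  apply/span_subvP => c; rewrite mem_enum => /bigcupP[a _].
  case/imset2P=> _ _ /imsetP[x Hx ->] /imsetP[y Hy ->] ->.
  rewrite -!addrA concatD -graph_unitw; apply: memv_add.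
    by rewrite mem_prodv -!mem_hammingv Hx.
  by apply/memv_imgP; exists (unitw (tau a) + unitw 0); rewrite ?lfunE ?even_unitwD.
rewrite !subv_add -andbA; apply/and3P; split; apply/subvP => _ /memv_imgP[y Hy ->];
  rewrite lfunE.
(* At [a = 0] both shifts cancel in characteristic 2, so H x H itself lies in the span. *)
- by have := SHtauI 0 y 0 Hy (mem0v _); rewrite tau0 -!addrA unitwK !addr0.
- by have := SHtauI 0 0 y (mem0v _) Hy; rewrite tau0 -!addrA unitwK !addr0.
(* By linearity it suffices to treat the graph word of [unitw b + unitw 0], which is the shift for
   the preimage of [b] under tau. *)
rewrite (even_sum_unitw 0 Hy) linear_sum; apply: memv_suml => b _.
rewrite linearZ; apply: memvZ; rewrite -(permKV tau b) /= graph_unitw.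
by have := SHtauI (tau^-1%g b) 0 0 (mem0v _) (mem0v _); rewrite !add0r.
Qed.

(** A graph word lies in H x H exactly when [y] and its inverse permutation lie in H; such a [y] is
    automatically even. *)
Lemma capv_graphw (tau : {perm V}) :
  (prodv hammingv hammingv :&: linfun (graphw tau) @: even_words V =
   linfun (graphw tau) @: perm_capv tau)%VS.
Proof.
apply/vspaceP => w; apply/memv_capP/memv_imgP.
  case=> + /memv_imgP[y Ey wE]; rewrite wE lfunE /= mem_prodv => /andP[Hty Hy].
  by exists y; rewrite ?lfunE // memv_cap -memv_preim lfunE Hy.
case=> y; rewrite memv_cap -memv_preim lfunE => /andP[Hy Hty] ->; split.
  by rewrite lfunE mem_prodv Hty.
apply: memv_img; exact: (subvP hammingv_even _ Hy).
Qed.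

(** The dimension formula for a sum of two subspaces, kept additive to avoid truncated
    subtraction. *)
Lemma rank_SHtau (tau : {perm V}) : tau 0 = 0 ->
  (rank (SHtau tau) + \dim (perm_capv tau) =
   \dim hammingv + \dim hammingv + \dim (even_words V))%N.
Proof.
move=> tau0; rewrite /rank (span_SHtau tau0) -(dim_graphw tau (perm_capv tau)) -capv_graphw.
by rewrite dimv_sum_cap (dim_graphw tau (even_words V)) dim_prodv.
Qed.

End Hamming.

Unset Implicit Arguments.

Theorem lemma1 (r : nat) (hr : (1 <= r)%N) (tau : {perm 'rV['F_2]_r})
    (htau : tau 0 = 0) (l : nat) (hl : l = distension tau) :
  rank (SHtau tau) = ((2 ^ (r + 1) - r - 2) + l)%N.
Proof.
have hN := dim_hammingv r.
have eN : (\dim (even_words 'rV['F_2]_r) + 1 = 2 ^ r)%N.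
  by rewrite (dim_even_words 0) card_mx card_Fp // mul1n.
(* The bound makes the subtraction in [distensionE] exact; the rank is then dim H + dim E + l, which
   is (2^r - r - 1) + (2^r - 1) + l. *)
have := dim_perm_capv tau; have := rank_SHtau htau.
rewrite hl distensionE (addn1 r) expnS.
lia.
Qed.
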